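(* For every computable metric space $X$, $\mathrm{C}_X'\equiv_{sW}\mathrm{CL}_X$.
   Context: A representation of a set $X$ is a surjective partial function $\delta:\subseteq\mathbb{N}^\mathbb{N}\to X$. For a partial multi-valued $f:\subseteq(X,\delta_X)\rightrightarrows(Y,\delta_Y)$ a realizer is a single-valued partial $F:\subseteq\mathbb{N}^\mathbb{N}\to\mathbb{N}^\mathbb{N}$ with $\delta_Y(F(p))\in f(\delta_X(p))$ for all $p\in\mathrm{dom}(f\circ\delta_X)$ ($F\vdash f$). $f\le_{sW}g$ iff there are computable partial $H,K:\subseteq\mathbb{N}^\mathbb{N}\to\mathbb{N}^\mathbb{N}$ with $H\circ G\circ K\vdash f$ for every $G\vdash g$; $\equiv_{sW}$ is mutual reducibility. A computable metric space is $(X,d,\alpha)$ with $(X,d)$ a metric space, $\alpha:\mathbb{N}\to X$ with dense range, and $(i,j)\mapsto d(\alpha(i),\alpha(j))$ a computable double sequence of reals; $X$ is represented by the Cauchy representation $\delta_X(p)=\lim_m\alpha(p(m))$ for those $p$ with $d(\alpha(p(m)),\alpha(p(k)))<2^{-m}$ for all $k>m$. $X^\mathbb{N}$ is represented by $\delta_X^\mathbb{N}\langle p_0,p_1,\ldots\rangle=(\delta_X(p_0),\delta_X(p_1),\ldots)$, where $\langle p_0,p_1,\ldots\rangle(\langle i,j\rangle)=p_i(j)$ for a standard computable pairing. With $(q_k)$ a standard enumeration of the non-negative rationals and $B_{\langle i,k\rangle}=\{x:d(\alpha(i),x)<q_k\}$, the set $\mathcal{A}(X)$ of closed subsets is represented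 by $\psi_-(p)=X\setminus\bigcup_iB_{p(i)}$. Closed choice $\mathrm{C}_X:\subseteq\mathcal{A}(X)\rightrightarrows X$, $A\mapsto A$ (any point of $A$), with domain the non-empty closed sets, input via $\psi_-$. The cluster point problem $\mathrm{CL}_X:\subseteq X^\mathbb{N}\rightrightarrows X$ maps a sequence $(x_n)$ to the set of its cluster points, with domain the sequences having at least one cluster point. $\lim:\subseteq\mathbb{N}^\mathbb{N}\to\mathbb{N}^\mathbb{N}$ maps $\langle p_0,p_1,\ldots\rangle$ to $\lim_ip_i$ whenever it exists. The derivative $f'$ of $f:\subseteq(X,\delta)\rightrightarrows Y$ is the same function with input representation $\delta\circ\lim$ instead of $\delta$. *)

(* Defs.v *)
From mathcomp Require Import all_boot all_order all_algebra.
From mathcomp Require Import all_classical all_reals all_analysis.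
From mathcomp Require Import metric_structure.
From Stdlib Require Cantor.

Set Implicit Arguments.
Unset Strict Implicit.
Unset Printing Implicit Defensive.

Import Order.TTheory GRing.Theory Num.Theory.
Local Open Scope classical_set_scope.

Notation baire := (nat -> nat).

(* Kleene's partial recursive functions with an oracle.  [reval o e v y] says
   that [e], with oracle [o], halts on the argument list [v] with value [y].
   [RPrec f g] recurses on the head of the list, [g] receiving the predecessor
   and the previous value in front of the parameters; [RMu f] searches for the
   least [n] such that [f] vanishes on [n :: v], [f] being defined below [n]. *)
Inductive recfun : Type :=
| RZero
| RSucc
| RProj of nat
| ROracle
| RComp of recfun & seq recfun
| RPrec of recfun & recfun
| RMu of recfun.

Inductive reval (o : baire) : recfun -> seq nat -> nat -> Prop :=
| reval_zero v : reval o RZero v 0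
| reval_succ x v : reval o RSucc (x :: v) x.+1
| reval_proj i v : i < size v -> reval o (RProj i) v (nth 0 v i)
| reval_oracle x v : reval o ROracle (x :: v) (o x)
| reval_comp f gs v ws y :
    size ws = size gs ->
    (forall i, i < size gs -> reval o (nth RZero gs i) v (nth 0 ws i)) ->
    reval o f ws y ->
    reval o (RComp f gs) v y
| reval_prec0 f g v y :
    reval o f v y ->
    reval o (RPrec f g) (0 :: v) y
| reval_precS f g n v x y :
    reval o (RPrec f g) (n :: v) x ->
    reval o g [:: n, x & v] y ->
    reval o (RPrec f g) (n.+1 :: v) y
| reval_mu f v n (u : nat -> nat) :
    (forall m, m < n -> reval o f (m :: v) (u m).+1) ->
    reval o f (n :: v) 0 ->
    reval o (RMu f) v n.

Definition computable3 (f : nat -> nat -> nat -> nat) : Prop :=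
  exists e, forall i j n, reval (fun=> 0) e [:: i; j; n] (f i j n).

Record pfun (A B : Type) := PFun {
  pgraph :> A -> B -> Prop;
  pfunP : is_fun pgraph }.

Lemma pcomp_subproof A B C (G : pfun B C) (F : pfun A B) :
  is_fun (fun a c => exists b, F a b /\ G b c).
Proof.
move=> a c c' [b [Fb Gc]] [b' [Fb' Gc']].
by rewrite (pfunP Fb' Fb) in Gc'; exact: pfunP Gc Gc'.
Qed.

Definition pcomp A B C (G : pfun B C) (F : pfun A B) : pfun A C :=
  PFun (@pcomp_subproof A B C G F).

(* Only the arguments in the domain of [F] matter, so that restrictions of
   computable functions are computable. *)
Definition computable_pfun (F : pfun baire baire) : Prop :=
  exists e, forall p q, F p q -> forall n, reval p e [:: n] (q n).

Record representation (X : Type) := Representation {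
  rep_pfun :> pfun baire X;
  rep_surj : forall x, exists p, rep_pfun p x }.

Record repSpace := RepSpace {
  rep_carrier :> Type;
  rep : representation rep_carrier }.

(* Partial multi-valued functions: the domain is where the value is nonempty. *)
Record mfun (X Y : repSpace) := MFun { mval :> X -> set Y }.

Definition mdom (X Y : repSpace) (f : mfun X Y) : set X := [set x | f x !=set0].

Definition realizes (X Y : repSpace) (F : pfun baire baire) (f : mfun X Y) :=
  forall p x, rep X p x -> mdom f x ->
  exists q y, [/\ F p q, rep Y q y & f x y].

Definition sW_le (X Y Z W : repSpace) (f : mfun X Y) (g : mfun Z W) : Prop :=
  exists H K : pfun baire baire,
    [/\ computable_pfun H, computable_pfun K &
        forall G, realizes G g -> realizes (pcomp H (pcomp G K)) f].

Definition sW_equiv (X Y Z W : repSpace) (f : mfun X Y) (g : mfun Z W) : Prop :=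
  sW_le f g /\ sW_le g f.

Definition pairn (i j : nat) : nat := Cantor.to_nat (i, j).

Definition unpairn (n : nat) : nat * nat := Cantor.of_nat n.

Lemma pairnK i j : unpairn (pairn i j) = (i, j).
Proof. exact: Cantor.cancel_of_to. Qed.

Lemma unpairnK n : pairn (unpairn n).1 (unpairn n).2 = n.
Proof. by rewrite /pairn -surjective_pairing; exact: Cantor.cancel_to_of. Qed.

Definition btuple (p : nat -> baire) : baire :=
  fun n => p (unpairn n).1 (unpairn n).2.

Lemma btuple_inj : injective btuple.
Proof.
move=> p p' pp'; apply/funext => i; apply/funext => j.
by have := congr1 (@^~ (pairn i j)) pp'; rewrite /btuple pairnK.
Qed.

(* [{ptws nat -> nat}] carries the product topology of discrete spaces. *)
Definition lim_graph (p q : baire) : Prop :=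
  exists2 ps : nat -> baire, p = btuple ps &
    (ps : nat -> {ptws nat -> nat}) @ \oo --> (q : {ptws nat -> nat}).

Lemma lim_subproof : is_fun lim_graph.
Proof.
move=> p q q' [ps -> cq] [ps' /btuple_inj <- cq'].
have hN : hausdorff_space {ptws nat -> nat}.
  by apply: hausdorff_product => _; exact: discrete_hausdorff.
exact: (cvg_unique hN cq cq').
Qed.

Definition lim_baire : pfun baire baire := PFun lim_subproof.

Lemma jump_subproof (X : repSpace) x :
  exists p, pcomp (rep X) lim_baire p x.
Proof.
have [q qx] := rep_surj (rep X) x.
exists (btuple (fun=> q)); exists q; split => //.
by exists (fun=> q) => //; exact: cvg_cst.
Qed.

Definition jump (X : repSpace) : repSpace :=
  RepSpace (Representation (@jump_subproof X)).

Definition derivative (X Y : repSpace) (f : mfun X Y) : mfun (jump X) Y :=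
  @MFun (jump X) Y (mval f).

Definition seq_graph (X : repSpace) (p : baire) (x : nat -> X) : Prop :=
  exists2 ps : nat -> baire, p = btuple ps & forall i, rep X (ps i) (x i).

Lemma seq_subproof (X : repSpace) : is_fun (@seq_graph X).
Proof.
move=> p x y [ps -> psx] [ps' /btuple_inj <- psy].
by apply/funext => i; exact: pfunP (psx i) (psy i).
Qed.

Lemma seq_surj (X : repSpace) (x : nat -> X) :
  exists p, PFun (@seq_subproof X) p x.
Proof.
have [ps psx] := choice (fun i => rep_surj (rep X) (x i)).
by exists (btuple ps), ps.
Qed.

Definition seqSpace (X : repSpace) : repSpace :=
  RepSpace (Representation (@seq_surj X)).

Local Open Scope ring_scope.

Section ComputableMetricSpaces.
Variable R : realType.

Definition nnrat (k : nat) : R := (unpairn k).1%:R / (unpairn k).2.+1%:R.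

Definition srat (k : nat) : R :=
  ((unpairn k).1%:R - (unpairn (unpairn k).2).1%:R)
  / (unpairn (unpairn k).2).2.+1%:R.

Definition computable_double_seq (r : nat -> nat -> R) : Prop :=
  exists2 f, computable3 f &
    forall i j n, `|srat (f i j n) - r i j| <= 2 ^- n.

Record compMetricSpace := CompMetricSpace {
  cms_metric :> metricType R;
  cms_alpha : nat -> cms_metric;
  cms_dense : dense (range cms_alpha);
  cms_dist : computable_double_seq
    (fun i j => mdist (cms_alpha i) (cms_alpha j)) }.

Variable X : compMetricSpace.
Local Notation alpha := (@cms_alpha X).

Lemma dense_approx (x : X) (e : R) : 0 < e -> exists i, mdist (alpha i) x < e.
Proof.
move=> e0; have [] := @cms_dense X (ball x e)°.
- by exists x; exact: nbhsx_ballx.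
- exact: open_interior.
move=> y [/interior_subset + [i _ iy]]; rewrite -{}iy ballEmdist/= metric_sym.
by exists i.
Qed.

Definition cauchy_graph (p : baire) (x : X) : Prop :=
  (forall m k, (m < k)%N -> mdist (alpha (p m)) (alpha (p k)) < 2 ^- m) /\
  (fun m => alpha (p m)) @ \oo --> x.

Lemma cauchy_subproof : is_fun cauchy_graph.
Proof.
by move=> p x y [_ px] [_ py]; exact: (cvg_unique (@metric_hausdorff R X) px py).
Qed.

Lemma cauchy_surj (x : X) : exists p, PFun cauchy_subproof p x.
Proof.
have e0 m : 0 < 2 ^- m.+1 :> R by rewrite invr_gt0 exprn_gt0.
have [p px] := choice (fun m => dense_approx x (e0 m)).
exists p; split => [m k mk|].
  rewrite (le_lt_trans (metric_triangle _ x _))//.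
  have -> : 2 ^- m = 2 ^- m.+1 + 2 ^- m.+1 :> R.
    by rewrite exprS invfM [2^-1 * _]mulrC -splitr.
  rewrite ltrD// metric_sym (lt_le_trans (px k))//.
  by rewrite lef_pV2 ?posrE ?exprn_gt0// ler_eXn2l ?ltr1n// ltnS ltnW.
apply/metricType_numDomainType.cvgrPdist_lt => e e_gt0.
have := @cvg_geometric R 1 2^-1.
rewrite ger0_norm ?invr_ge0// invf_lt1// ltr1n => /(_ isT).
move/cvgr0Pnorm_lt => /(_ e e_gt0); apply: filterS => m.
rewrite /geometric/= mul1r ger0_norm ?exprn_ge0 ?invr_ge0// => me.
rewrite metric_sym (lt_trans (px m))// (le_lt_trans _ me)//.
by rewrite exprVn lef_pV2 ?posrE ?exprn_gt0// ler_eXn2l ?ltr1n.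
Qed.

Definition cauchySpace : repSpace := RepSpace (Representation cauchy_surj).

Definition rball (n : nat) : set X :=
  [set x | mdist (alpha (unpairn n).1) x < nnrat (unpairn n).2].

Definition closed_subset : Type := {A : set X | closed A}.

Definition psi_graph (p : baire) (A : closed_subset) : Prop :=
  sval A = ~` \bigcup_i rball (p i).

Lemma psi_subproof : is_fun psi_graph.
Proof.
move=> p [A cA] [B cB]; rewrite /psi_graph/= => pA pB.
by apply: eq_exist; rewrite pA pB.
Qed.

Lemma psi_surj (A : closed_subset) : exists p, PFun psi_subproof p A.
Proof.
pose p n := if `[< rball n `<=` ~` sval A >] then n
            else pairn 0 (pairn 0 0).
exists p; rewrite /= /psi_graph; apply/seteqP; split=> [x Ax [n _]|x px].
  rewrite /p; case: asboolP => [nA nx|_]; first exact: (nA x nx Ax).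
  by rewrite /rball/= /nnrat/= mul0r ltNge mdist_ge0.
apply: contrapT => nAx; apply: px.
have oA : open (~` sval A) by rewrite openC; exact: (svalP A).
have /nbhs_ballP[e /= e0 xeA] : nbhs x (~` sval A) by exact: open_nbhs_nbhs.
have e20 : 0 < e / 2 by rewrite divr_gt0.
have [k ke] : exists k, k.+1%:R^-1 < e / 2.
  exists (Num.truncn (e / 2)^-1); rewrite -[ltRHS]invrK ltf_pV2 ?posrE ?invr_gt0//.
  exact: truncnS_gt.
have k0 : 0 < k.+1%:R^-1 :> R by rewrite invr_gt0.
have [i ix] := dense_approx x k0.
pose n := pairn i (pairn 1 k).
have nE : rball n = [set y | mdist (alpha i) y < k.+1%:R^-1].
  by rewrite /rball /n /nnrat !pairnK/= mul1r.
exists n => //; rewrite /p; case: asboolP => [_|]; first by rewrite nE.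
move=> nn; exfalso; apply: nn; rewrite nE => y iy.
apply: xeA; rewrite ballEmdist/=.
rewrite (le_lt_trans (metric_triangle _ (alpha i) _))// (splitr e) ltrD//.
  by rewrite metric_sym (lt_trans ix).
exact: lt_trans ke.
Qed.

Definition closedSpace : repSpace := RepSpace (Representation psi_surj).

Definition closed_choice : mfun closedSpace cauchySpace :=
  @MFun closedSpace cauchySpace (fun A => sval A).

Definition cluster_point_problem : mfun (seqSpace cauchySpace) cauchySpace :=
  @MFun (seqSpace cauchySpace) cauchySpace (fun x => cluster ((x : nat -> X) @ \oo)).

End ComputableMetricSpaces.

(* Main.v *)
(**
Both reductions use the identity as outer function.

From the cluster point problem to the jump of closed choice: the complement of
the set of cluster points of (x_n) is the union of the rational balls B for
which some m satisfies x_i \notin B for all i >= m.  Membership of x_i in B is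
semi-decidable, so for each pair (B, m) one outputs B until some x_i in B with
i >= m is discovered, and the empty ball afterwards; this converges pointwise
to a negative name of the set of cluster points.

From the jump of closed choice to the cluster point problem: let q_s converge
to a negative name q of A.  For each k fix a decidable maximal 2^-(k+2)-separated
set of indices of the dense sequence.  An event (j, k, s) with s >= k fires if j
belongs to that set, alpha(j) is, up to an error O(2^-k), outside the first k
balls of q_s, and s = k or the first k entries of q_s differ from those of
q_(s-1).  For fixed k only finitely many s fire and the alpha(j) are uniformly
separated, so a cluster point of the points alpha(j) of the firing events
requires k to be unbounded, hence lies in A; conversely every point of A is
approached by a firing event for each k.
*)
From mathcomp Require Import all_boot all_order all_algebra.
From mathcomp Require Import all_classical all_reals all_analysis.
From mathcomp Require Import metric_structure ring lra.
From Stdlib Require Cantor.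
Require Import Defs.

Set Implicit Arguments.
Unset Strict Implicit.
Unset Printing Implicit Defensive.

Import Order.TTheory GRing.Theory Num.Theory.
Local Open Scope classical_set_scope.

(** * Closure properties of relative computability *)

(* A context presents a family of inputs (oracle and argument list) indexed by
   an arbitrary type, so that [rc] is totality and computability on that family
   only; binders become context extensions. *)
Record context := Context {
  ctx_point :> Type;
  ctx_oracle : ctx_point -> baire;
  ctx_args : ctx_point -> seq nat;
  ctx_arity : nat;
  ctx_arityP : forall x, size (ctx_args x) = ctx_arity }.

Lemma ctx_ext_subproof (C : context) (z : C * nat) :
  size (z.2 :: ctx_args z.1) = (ctx_arity C).+1.
Proof. by rewrite /= ctx_arityP. Qed.

Definition ctx_ext (C : context) : context :=
  @Context (C * nat) (fun z => ctx_oracle z.1) _ _ (@ctx_ext_subproof C).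

(** [E] plays the role of a domain: a program has to halt only on the oracles [o x], which is how
    partial functions on Baire space enter. *)
Definition ctx_baire (E : Type) (o : E -> baire) : context :=
  @Context (E * nat) (fun z => o z.1) (fun z => [:: z.2]) 1 (fun=> erefl).

Definition rc (C : context) (f : C -> nat) : Prop :=
  exists e, forall x, reval (ctx_oracle x) e (ctx_args x) (f x).

Lemma rc_var (C : context) i (f : C -> nat) :
  i < ctx_arity C -> (forall x, f x = nth 0 (ctx_args x) i) -> rc f.
Proof.
move=> iC fE; exists (RProj i) => x; rewrite fE; apply: reval_proj.
by rewrite ctx_arityP.
Qed.

Lemma rc_subst (C D : context) (s : D -> C) (f : C -> nat) :
  (forall x, ctx_oracle (s x) = ctx_oracle x) ->
  (forall i, i < ctx_arity C -> rc (fun x => nth 0 (ctx_args (s x)) i)) ->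
  rc f -> rc (fun x => f (s x)).
Proof.
move=> so sa [e ef].
have {sa} /choice[es esP] : forall i, exists ei, i < ctx_arity C ->
    forall x : D, reval (ctx_oracle x) ei (ctx_args x) (nth 0 (ctx_args (s x)) i).
  move=> i; have [iC|] := boolP (i < ctx_arity C); last by exists RZero.
  by have [a aP] := sa i iC; exists a.
exists (RComp e (mkseq es (ctx_arity C))) => x.
apply: (reval_comp (ws := ctx_args (s x))).
- by rewrite size_mkseq ctx_arityP.
- by move=> i; rewrite size_mkseq => iC; rewrite nth_mkseq//; exact: esP.
- by rewrite -so; exact: ef.
Qed.

Section Closure.
Variable C : context.
Implicit Types (f g h : C -> nat).

Lemma rc_ext f g : f =1 g -> rc f -> rc g.
Proof. by move=> fg [e ef]; exists e => x; rewrite -fg. Qed.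

Lemma rc_comp1 e (F : C -> nat -> nat) f :
  (forall x m, reval (ctx_oracle x) e [:: m] (F x m)) -> rc f ->
  rc (fun x => F x (f x)).
Proof.
move=> eF [ef fP]; exists (RComp e [:: ef]) => x.
by apply: (reval_comp (ws := [:: f x])) => // -[].
Qed.

Lemma rc_succ f : rc f -> rc (fun x => (f x).+1).
Proof. by apply: (rc_comp1 (e := RSucc) (F := fun=> S)) => x m; exact: reval_succ. Qed.

Lemma rc_oracle f : rc f -> rc (fun x => ctx_oracle x (f x)).
Proof. by apply: (rc_comp1 (e := ROracle) (F := @ctx_oracle C)) => x m; exact: reval_oracle. Qed.

Lemma rc_const n : rc (fun _ : C => n).
Proof.
by elim: n => [|n IH]; [exists RZero => x; exact: reval_zero | exact: rc_succ].
Qed.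

Lemma rc_extend (F : C -> nat -> nat) f :
  rc (C := ctx_ext C) (fun z => F z.1 z.2) -> rc f -> rc (fun x => F x (f x)).
Proof.
move=> rF rf; apply: (@rc_subst (ctx_ext C) C (fun x => (x, f x))) rF => //= -[|i] //.
by rewrite ltnS => iC; exact: rc_var iC _.
Qed.

Lemma rc_weaken f : rc f -> rc (C := ctx_ext C) (fun z => f z.1).
Proof.
move=> rf; apply: (@rc_subst C (ctx_ext C) (fun z => z.1)) rf => // i iC.
exact: (rc_var (C := ctx_ext C) (i := i.+1)).
Qed.

Lemma rc_weaken1 (F : C -> nat -> nat) :
  rc (C := ctx_ext C) (fun z => F z.1 z.2) ->
  rc (C := ctx_ext (ctx_ext C)) (fun z => F z.1.1 z.2).
Proof.
apply: (@rc_subst (ctx_ext C) (ctx_ext (ctx_ext C)) (fun z => (z.1.1, z.2))) => //.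
move=> [_|i iC]; first exact: (rc_var (i := 0)).
exact: (rc_var (C := ctx_ext (ctx_ext C)) (i := i.+2)).
Qed.

(** The newest variable is the predecessor and the one below it the accumulated value, as in the
    argument order of [RPrec]. *)
Lemma rc_iteri (F : C -> nat -> nat -> nat) f g :
  rc (C := ctx_ext (ctx_ext C)) (fun z => F z.1.1 z.2 z.1.2) ->
  rc f -> rc g -> rc (fun x => iteri (g x) (F x) (f x)).
Proof.
move=> [e eF] [ef fP]; apply: (rc_extend (F := fun x n => iteri n (F x) (f x))).
exists (RPrec ef e) => -[x n] /=.
elim: n => [|n IH]; first by apply: reval_prec0.
by apply: reval_precS IH _; exact: (eF (x, _, n)).
Qed.

Lemma rc_iter (F : C -> nat -> nat) f g :
  rc (C := ctx_ext (ctx_ext C)) (fun z => F z.1.1 z.1.2) ->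
  rc f -> rc g -> rc (fun x => iter (g x) (F x) (f x)).
Proof.
move=> rF rf rg; apply: rc_ext (rc_iteri (F := fun x _ m => F x m) rF rf rg).
by move=> x; elim: (g x) => //= n ->.
Qed.

Lemma rc_mu (P : C -> nat -> bool) f :
  (forall x, P x (f x)) -> (forall x m, P x m -> f x <= m) ->
  rc (C := ctx_ext C) (fun z => ~~ P z.1 z.2) -> rc f.
Proof.
move=> Pf fmin [e eP]; exists (RMu e) => x.
(* [RMu] looks for a zero, hence the negated test; below [f x] it evaluates to [1], the successor of
   [0]. *)
apply: (reval_mu (u := fun=> 0)) => [m mf|].
  have := eP (x, m); rewrite /=; case: (boolP (P x m)) => // /fmin.
  by rewrite leqNgt mf.
by have := eP (x, f x); rewrite /= Pf.
Qed.

End Closure.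

(** * Arithmetic, Boolean connectives and bounded operators *)

Ltac rc_var_tac :=
  first [ exact: (rc_var (i := 0)) | exact: (rc_var (i := 1))
        | exact: (rc_var (i := 2)) | exact: (rc_var (i := 3))
        | exact: (rc_var (i := 4)) | exact: (rc_var (i := 5)) ].

Lemma rc_lift2 (C : context) (op : nat -> nat -> nat) (f g : C -> nat) :
  rc (C := ctx_ext (ctx_ext C)) (fun z => op z.2 z.1.2) ->
  rc f -> rc g -> rc (fun x => op (f x) (g x)).
Proof.
move=> rop rf; apply: (rc_extend (F := fun x n => op (f x) n)).
apply: (rc_extend (C := ctx_ext C) (F := fun z m => op m z.2)) (rc_weaken rf).
exact: rop.
Qed.

Lemma rc_add (C : context) (f g : C -> nat) :
  rc f -> rc g -> rc (fun x => f x + g x).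
Proof.
move=> rf rg; apply: (@rc_ext C (fun x => iter (g x) S (f x))).
  by move=> x; elim: (g x) => [|n IH] /=; rewrite ?addn0// IH addnS.
by apply: (rc_iter (F := fun=> S)) => //; apply: rc_succ; rc_var_tac.
Qed.

Lemma rc_mul (C : context) (f g : C -> nat) :
  rc f -> rc g -> rc (fun x => f x * g x).
Proof.
apply: rc_lift2; set D := ctx_ext (ctx_ext C).
apply: (@rc_ext D (fun z => iter z.1.2 (addn z.2) 0)).
  by move=> z /=; elim: z.1.2 => [|n IH] /=; rewrite ?muln0// IH mulnS.
apply: (rc_iter (C := D) (F := fun z => addn z.2)).
- by apply: rc_add; rc_var_tac.
- exact: rc_const.
- by rc_var_tac.
Qed.

Lemma rc_exp (C : context) (f g : C -> nat) :
  rc f -> rc g -> rc (fun x => f x ^ g x).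
Proof.
apply: rc_lift2; set D := ctx_ext (ctx_ext C).
apply: (@rc_ext D (fun z => iter z.1.2 (muln z.2) 1)).
  by move=> z /=; elim: z.1.2 => [|n IH] //=; rewrite IH expnS.
apply: (rc_iter (C := D) (F := fun z => muln z.2)).
- by apply: rc_mul; rc_var_tac.
- exact: rc_const.
- by rc_var_tac.
Qed.

Lemma rc_pred (C : context) (f : C -> nat) : rc f -> rc (fun x => (f x).-1).
Proof.
move=> rf; apply: (@rc_ext C (fun x => iteri (f x) (fun i _ => i) 0)).
  by move=> x; case: (f x).
apply: (rc_iteri (F := fun _ i _ => i)) => //; last exact: rc_const.
by rc_var_tac.
Qed.

Lemma rc_sub (C : context) (f g : C -> nat) :
  rc f -> rc g -> rc (fun x => f x - g x).
Proof.
move=> rf rg; apply: (@rc_ext C (fun x => iter (g x) predn (f x))).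
  by move=> x; elim: (g x) => [|n IH] /=; rewrite ?subn0// IH subnS.
by apply: (rc_iter (F := fun=> predn)) => //; apply: rc_pred; rc_var_tac.
Qed.

Lemma rc_negb (C : context) (P : C -> bool) : rc P -> rc (fun x => ~~ P x).
Proof.
move=> rP; apply: (@rc_ext C (fun x => 1 - P x)); first by move=> x; case: (P x).
by apply: rc_sub => //; exact: rc_const.
Qed.

Lemma rc_andb (C : context) (P Q : C -> bool) :
  rc P -> rc Q -> rc (fun x => P x && Q x).
Proof.
move=> rP rQ; apply: (@rc_ext C (fun x => P x * Q x)); last exact: rc_mul.
by move=> x; rewrite mulnb.
Qed.

Lemma rc_orb (C : context) (P Q : C -> bool) :
  rc P -> rc Q -> rc (fun x => P x || Q x).
Proof.
move=> rP rQ; apply: (@rc_ext C (fun x => ~~ (~~ P x && ~~ Q x))).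
  by move=> x; rewrite negb_and !negbK.
by apply: rc_negb; apply: rc_andb; exact: rc_negb.
Qed.

Lemma rc_leq (C : context) (f g : C -> nat) :
  rc f -> rc g -> rc (fun x => f x <= g x).
Proof.
move=> rf rg; apply: (@rc_ext C (fun x => 1 - (f x - g x))).
  by move=> x; rewrite /leq; case: (f x - g x).
by apply: rc_sub; [exact: rc_const | exact: rc_sub].
Qed.

Lemma rc_eqn (C : context) (f g : C -> nat) :
  rc f -> rc g -> rc (fun x => f x == g x).
Proof.
move=> rf rg; apply: (@rc_ext C (fun x => (f x <= g x) && (g x <= f x))).
  by move=> x; rewrite eqn_leq.
by apply: rc_andb; exact: rc_leq.
Qed.

Lemma rc_all (C : context) (P : C -> nat -> bool) (f : C -> nat) :
  rc (C := ctx_ext C) (fun z => P z.1 z.2) -> rc f ->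
  rc (fun x => all (P x) (iota 0 (f x))).
Proof.
move=> rP rf.
apply: (@rc_ext C (fun x => iteri (f x) (fun i b => b * P x i) 1)).
  move=> x; elim: (f x) => // n IH.
  by rewrite -[in RHS]addn1 iotaD all_cat/= andbT -mulnb -IH.
apply: (rc_iteri (F := fun x i b => b * P x i)) => //; last exact: rc_const.
apply: rc_mul; first by rc_var_tac.
exact: (rc_weaken1 (F := fun x i => nat_of_bool (P x i))).
Qed.

Lemma rc_sum (C : context) (F : C -> nat -> nat) (f : C -> nat) :
  rc (C := ctx_ext C) (fun z => F z.1 z.2) -> rc f ->
  rc (fun x => \sum_(i < f x) F x i).
Proof.
move=> rF rf.
apply: (@rc_ext C (fun x => iteri (f x) (fun i b => b + F x i) 0)).
  move=> x; elim: (f x) => [|n IH] /=; first by rewrite big_ord0.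
  by rewrite big_ord_recr/= IH.
apply: (rc_iteri (F := fun x i b => b + F x i)) => //; last exact: rc_const.
by apply: rc_add; [rc_var_tac | exact: rc_weaken1].
Qed.

(** [computable3] runs programs with the zero oracle; replacing oracle calls by the constant zero
    lets them run beside any oracle. *)
Fixpoint recfun_unoracle (e : recfun) : recfun :=
  match e with
  | ROracle => RZero
  | RComp f gs => RComp (recfun_unoracle f) (map recfun_unoracle gs)
  | RPrec f g => RPrec (recfun_unoracle f) (recfun_unoracle g)
  | RMu f => RMu (recfun_unoracle f)
  | _ => e
  end.

Lemma reval_unoracle o e v y :
  reval (fun=> 0) e v y -> reval o (recfun_unoracle e) v y.
Proof.
elim=> {e v y} [v|x v|i v iv|x v|f gs v ws y sz _ IHgs _ IHf|f g v y _ IH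
  |f g n v x y _ IHf _ IHg|f v n u _ IHu _ IH] /=.
- exact: reval_zero.
- exact: reval_succ.
- exact: reval_proj.
- exact: reval_zero.
- apply: (reval_comp (ws := ws)) IHf; first by rewrite size_map.
  by move=> i; rewrite size_map => ig; rewrite (nth_map RZero)//; exact: IHgs.
- exact: reval_prec0.
- exact: reval_precS IHf IHg.
- exact: reval_mu IHu IH.
Qed.

Lemma rc_computable3 (C : context) F (f g h : C -> nat) : computable3 F ->
  rc f -> rc g -> rc h -> rc (fun x => F (f x) (g x) (h x)).
Proof.
move=> [e eF] [ef fP] [eg gP] [eh hP].
exists (RComp (recfun_unoracle e) [:: ef; eg; eh]) => x.
apply: (reval_comp (ws := [:: f x; g x; h x])) => //; first by move=> [|[|[|i]]] //= _.
exact: reval_unoracle.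
Qed.

(** * The pairing function and its projections *)

Lemma pairnE i j : pairn i j = j + \sum_(k < (j + i).+1) k.
Proof.
rewrite /pairn /Cantor.to_nat plusE; congr (_ + _).
elim: (j + i) => [|n IH] /=; first by rewrite big_ord1.
by rewrite [RHS]big_ord_recr/= -IH addnC.
Qed.

Lemma pairn_gel i j : i <= pairn i j.
Proof.
have /ssrnat.leP := Cantor.to_nat_non_decreasing i j.
by apply: leq_trans; exact: leq_addl.
Qed.

Lemma pairn_ger i j : j <= pairn i j.
Proof.
have /ssrnat.leP := Cantor.to_nat_non_decreasing i j.
by apply: leq_trans; exact: leq_addr.
Qed.

(** Both components of [n] are at most [n], so exactly one summand survives. This makes the
    projections computable from the pairing. *)
Lemma sum_unpairn (F : nat -> nat -> nat) n :
  \sum_(i < n.+1) \sum_(j < n.+1) F i j * (pairn i j == n) =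
  F (unpairn n).1 (unpairn n).2.
Proof.
set i0 := (unpairn n).1; set j0 := (unpairn n).2.
have i0n : i0 < n.+1 by rewrite ltnS -[leqRHS]unpairnK pairn_gel.
have j0n : j0 < n.+1 by rewrite ltnS -[leqRHS]unpairnK pairn_ger.
have ij i j : (pairn i j == n) = (i == i0) && (j == j0).
  apply/eqP/andP => [ijn|[/eqP -> /eqP ->]]; last exact: unpairnK.
  by rewrite /i0 /j0 -ijn pairnK.
rewrite (bigD1 (Ordinal i0n))//= [X in _ + X]big1 ?addn0 => [|i ii0].
  rewrite (bigD1 (Ordinal j0n))//= big1 ?addn0 => [|j jj0].
    by rewrite unpairnK eqxx muln1.
  by rewrite ij [_ == j0]negbTE ?andbF ?muln0.
by rewrite big1// => j _; rewrite ij [_ == i0]negbTE ?muln0.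
Qed.

Lemma rc_pairn (C : context) (f g : C -> nat) :
  rc f -> rc g -> rc (fun x => pairn (f x) (g x)).
Proof.
move=> rf rg; apply: (@rc_ext C (fun x => g x + \sum_(k < (g x + f x).+1) k)).
  by move=> x; rewrite pairnE.
apply: rc_add => //; apply: (rc_sum (F := fun _ k => k)); first by rc_var_tac.
by apply: rc_succ; exact: rc_add.
Qed.

Lemma rc_unpairn (C : context) (F : nat -> nat -> nat) (f : C -> nat) :
  (forall D : context, rc (C := ctx_ext (ctx_ext D)) (fun z => F z.1.2 z.2)) ->
  rc f -> rc (fun x => F (unpairn (f x)).1 (unpairn (f x)).2).
Proof.
move=> rF; apply: (rc_extend (F := fun _ n => F (unpairn n).1 (unpairn n).2)).
apply: rc_ext; first by move=> z; exact: sum_unpairn.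
pose D := ctx_ext C.
apply: (@rc_sum D (fun z i => \sum_(j < z.2.+1) F i j * (pairn i j == z.2)));
  last by apply: rc_succ; rc_var_tac.
apply: (@rc_sum (ctx_ext D) (fun z j => F z.2 j * (pairn z.2 j == z.1.2)));
  last by apply: rc_succ; rc_var_tac.
apply: rc_mul; first exact: rF.
by apply: rc_eqn; first apply: rc_pairn; rc_var_tac.
Qed.

Lemma rc_unpair1 (C : context) (f : C -> nat) :
  rc f -> rc (fun x => (unpairn (f x)).1).
Proof. by apply: (rc_unpairn (F := fun i _ => i)) => D; rc_var_tac. Qed.

Lemma rc_unpair2 (C : context) (f : C -> nat) :
  rc f -> rc (fun x => (unpairn (f x)).2).
Proof. by apply: (rc_unpairn (F := fun _ j => j)) => D; rc_var_tac. Qed.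

Ltac rc_tac := repeat first
  [ exact: rc_const | rc_var_tac
  | match goal with H : rc _ |- _ => first
      [ exact: H | exact: (rc_weaken H) | exact: (rc_weaken (rc_weaken H)) ] end
  | apply: rc_pairn | apply: rc_unpair1 | apply: rc_unpair2
  | apply: rc_add | apply: rc_mul | apply: rc_sub | apply: rc_exp
  | apply: rc_andb | apply: rc_orb | apply: rc_negb
  | apply: rc_eqn | apply: rc_leq | apply: rc_succ | apply: rc_pred
  | apply: rc_oracle ].

(** * Reductions with identity outer function; limits in Baire space *)

Lemma pfun_on_subproof (E : Type) (o : E -> baire) (k : E -> baire) :
  injective o -> is_fun (fun p q => exists2 x, o x = p & k x = q).
Proof.
by move=> oI p q q' [x xp <-] [x' xp' <-]; rewrite -xp in xp'; rewrite (oI _ _ xp').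
Qed.

Definition pfun_on (E : Type) (o : E -> baire) (oI : injective o)
    (k : E -> baire) : pfun baire baire :=
  PFun (pfun_on_subproof (k := k) oI).

Lemma computable_pfun_on (E : Type) (o : E -> baire) (oI : injective o) k :
  rc (C := ctx_baire o) (fun z => k z.1 z.2) -> computable_pfun (pfun_on oI k).
Proof. by move=> [e ek]; exists e => _ _ [x <- <-] n; exact: (ek (x, n)). Qed.

(** The outer function is the identity, so every answer for [g] must already be one for [f]. The
    type [E] can carry a proof that the inner search terminates. *)
Lemma sW_le_on (X Y Z : repSpace) (f : mfun X Y) (g : mfun Z Y)
    (E : Type) (o : E -> baire) (k : E -> baire) : injective o ->
  rc (C := ctx_baire o) (fun z => k z.1 z.2) ->
  (forall p x, rep X p x -> mdom f x -> exists e z,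
    [/\ o e = p, rep Z (k e) z, mdom g z & g z `<=` f x]) ->
  sW_le f g.
Proof.
move=> oI rk kP; exists (pfun_on (o := id) (fun _ _ => id) id), (pfun_on oI k).
split; [by apply: computable_pfun_on; rc_tac | exact: computable_pfun_on |].
move=> G Gg p x px /(kP _ _ px)[e [z [ep kz gz zx]]].
have [q [y [Gq qy zy]]] := Gg _ _ kz gz.
exists q, y; split => //; last exact: zx.
by exists q; split; [exists (k e); split => //; exists e | exists q].
Qed.

Lemma lim_graphP (ps : nat -> baire) (q : baire) :
  lim_graph (btuple ps) q <->
  forall i, exists N, forall s, N <= s -> ps s i = q i.
Proof.
split=> [[ps' /btuple_inj <- cq] i|psq].
  have /discrete_cvg : proj i (ps s : {ptws nat -> nat}) @[s --> \oo] --> q i.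
    apply: (cvg_comp _ _ cq); exact: (@proj_continuous nat (fun=> nat) i q).
  by move=> [N _ Nq]; exists N => s /Nq.
exists ps => //; apply/cvg_sup => i; apply/cvg_image.
  by apply/seteqP; split => // x _; exists (fun=> x).
move=> U /nbhs_singleton Uq; exists [set g : nat -> nat | U (g i)].
  by have [N Nq] := psq i; exists N => // s /Nq /= ->.
by apply/seteqP; split=> [_ [g Ug <-] //|x Ux]; exists (fun=> x).
Qed.

(* Over a common denominator, [lt_test c m r] compares [srat c + 2 / 2 ^ m]
   with [nnrat r]. *)
Definition lt_test (c m r : nat) : bool :=
  (unpairn c).1 * 2 ^ m * (unpairn r).2.+1
    + 2 * (unpairn (unpairn c).2).2.+1 * (unpairn r).2.+1
  < (unpairn r).1 * (unpairn (unpairn c).2).2.+1 * 2 ^ m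
    + (unpairn (unpairn c).2).1 * 2 ^ m * (unpairn r).2.+1.

Lemma rc_lt_test (C : context) (f g h : C -> nat) :
  rc f -> rc g -> rc h -> rc (fun x => lt_test (f x) (g x) (h x)).
Proof. by rewrite /lt_test => rf rg rh; rc_tac. Qed.

Local Open Scope ring_scope.

Lemma lt_testE (R : realType) c m r :
  lt_test c m r = (srat R c + 2 * 2 ^- m < nnrat R r).
Proof.
rewrite /lt_test /srat /nnrat -(ltr_nat R).
move: (unpairn c).1 (unpairn (unpairn c).2).1 (unpairn (unpairn c).2).2.
move: (unpairn r).1 (unpairn r).2.
move=> u v a b d; rewrite !natrD !natrM !natrX.
have d0 : 0 < d.+1%:R :> R by rewrite ltr0n.
have v0 : 0 < v.+1%:R :> R by rewrite ltr0n.
have e0 : 0 < 2 ^+ m :> R by rewrite exprn_gt0.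
move: d.+1%:R v.+1%:R (2 ^+ m) d0 v0 e0 => D V M D0 V0 M0.
have D0' : D != 0 by rewrite gt_eqF.
have M0' : M != 0 by rewrite gt_eqF.
have -> : (a%:R - b%:R) / D + 2 / M = ((a%:R - b%:R) * M + 2 * D) / (D * M).
  by field; rewrite D0' M0'.
rewrite ltr_pdivrMr ?mulr_gt0// [X in _ = (_ < X)]mulrAC ltr_pdivlMr//.
rewrite -subr_gt0 -[RHS]subr_gt0; congr (0 < _); ring.
Qed.


(** * Computable metric spaces *)

Lemma expr2V_gt0 (R : realType) m : 0 < 2 ^- m :> R.
Proof. by rewrite invr_gt0 exprn_gt0. Qed.

Lemma expr2VS (R : realType) m : 2 ^- m = 2 * 2 ^- m.+1 :> R.
Proof. by rewrite exprS invfM mulrA divff ?mul1r. Qed.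

Lemma ler_expr2V (R : realType) m n : (m <= n)%N -> 2 ^- n <= 2 ^- m :> R.
Proof.
by move=> mn; rewrite lef_pV2 ?posrE ?exprn_gt0// ler_eXn2l ?ltr1n.
Qed.

Lemma expr2V_small (R : realType) (e : R) : 0 < e -> exists m, 2 ^- m < e.
Proof.
move=> e0; exists (Num.truncn e^-1).+1.
rewrite -[ltRHS]invrK ltf_pV2 ?posrE ?invr_gt0 ?exprn_gt0//.
by rewrite (lt_le_trans (truncnS_gt _))// -natrX ler_nat ltnW// ltn_expl.
Qed.

Lemma cluster_seqP (T : topologicalType) (x : nat -> T) (y : T) :
  cluster (x @ \oo) y <->
  forall U, nbhs y U -> forall N, exists2 n, (N <= n)%N & U (x n).
Proof.
split=> [cy U Uy N|cy V U [N _ NV] Uy].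
  have [|_ [[n Nn <-] Uxn]] := cy [set x n | n in [set n | (N <= n)%N]] U _ Uy.
    by exists N => // n Nn; exists n.
  by exists n.
by have [n Nn Un] := cy U Uy N; exists (x n); split => //; exact: NV.
Qed.

(** * Distance tests, rational balls and Cauchy names *)

Section ComputableMetric.
Variables (R : realType) (X : compMetricSpace R) (f : nat -> nat -> nat -> nat).
Hypothesis f_computable : computable3 f.
Local Notation alpha := (@cms_alpha R X).
Hypothesis fP : forall i j n,
  `|srat R (f i j n) - mdist (alpha i) (alpha j)| <= 2 ^- n.

(** The approximation [f i j m] is off by at most [2 ^- m] and the test adds [2 * 2 ^- m].
    Acceptance thus certifies the inequality with [2 ^- m] to spare; rejection leaves a slack of
    [3 * 2 ^- m]. *)
Definition closer i j m r : bool := lt_test (f i j m) m r.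

Lemma rc_closer (C : context) (a b c d : C -> nat) : rc a -> rc b -> rc c -> rc d ->
  rc (fun x => closer (a x) (b x) (c x) (d x)).
Proof. by move=> ra rb rc0 rd; apply: rc_lt_test => //; exact: rc_computable3. Qed.

Lemma closerT i j m r :
  closer i j m r -> mdist (alpha i) (alpha j) + 2 ^- m < nnrat R r.
Proof.
rewrite /closer (lt_testE R) => h.
by have := fP i j m; rewrite ler_norml => /andP[] *; lra.
Qed.

Lemma closerF i j m r :
  ~~ closer i j m r -> nnrat R r <= mdist (alpha i) (alpha j) + 3 * 2 ^- m.
Proof.
rewrite /closer (lt_testE R) -leNgt => h.
by have := fP i j m; rewrite ler_norml => /andP[] *; lra.
Qed.

Lemma closer_complete i j m r :
  mdist (alpha i) (alpha j) + 3 * 2 ^- m < nnrat R r -> closer i j m r.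
Proof.
rewrite /closer (lt_testE R) => h.
by have := fP i j m; rewrite ler_norml => /andP[] *; lra.
Qed.

Lemma cauchy_mdist p (x : X) m : cauchy_graph p x -> mdist (alpha (p m)) x <= 2 ^- m.
Proof.
move=> [pc px]; apply/ler_addgt0Pr => e e0.
have [N _ Nx] := metricType_numDomainType.cvgr_dist_lt px e0.
have /Nx /= Nx' : (N <= maxn N m.+1)%N by exact: leq_maxl.
rewrite (le_trans (metric_triangle _ (alpha (p (maxn N m.+1))) _))//.
by rewrite lerD ?(ltW (pc _ _ _)) ?leq_maxr// metric_sym ltW.
Qed.

Lemma cauchy_const i : cauchy_graph (fun=> i) (alpha i).
Proof.
split=> [m k _|]; last exact: cvg_cst.
by rewrite mdistxx expr2V_gt0.
Qed.

Lemma rball_nbhs b (y : X) : rball b y -> nbhs y (rball b).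
Proof.
move=> yb; apply/nbhs_ballP.
exists (nnrat R (unpairn b).2 - mdist (alpha (unpairn b).1) y).
  by rewrite /= subr_gt0.
move=> z; rewrite ballEmdist /rball/= => yz.
by rewrite (le_lt_trans (metric_triangle _ y _))// addrC -ltrBrDr.
Qed.

Lemma rball_basis (y : X) U : nbhs y U -> exists b, rball b y /\ rball b `<=` U.
Proof.
move=> /nbhs_ballP[e /= e0 eU].
have [m me] := expr2V_small e0.
have [i iy] := dense_approx y (expr2V_gt0 R m.+1).
(* [nnrat] divides by the successor of its code, so [(2 ^ m.+1).-1] encodes the radius
   [2 ^- m.+1]. *)
have nE z : rball (X := X) (pairn i (pairn 1 (2 ^ m.+1).-1)) z =
    (mdist (alpha i) z < 2 ^- m.+1) :> Prop.
  by rewrite /rball /nnrat /= !pairnK/= mul1r prednK ?expn_gt0// natrX.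
exists (pairn i (pairn 1 (2 ^ m.+1).-1)); split; rewrite ?nE// => z; rewrite nE => iz.
apply: eU; rewrite ballEmdist/= (le_lt_trans (metric_triangle _ (alpha i) _))//.
by rewrite (lt_trans _ me)// (expr2VS R m) mulr_natl mulr2n ltrD// metric_sym.
Qed.

(** Code [0] has radius zero and serves as the entry of a negative name that removes nothing. *)
Lemma rball0 (y : X) : ~ rball 0 y.
Proof.
by rewrite /rball /nnrat/= mul0r ltNge mdist_ge0.
Qed.

Lemma closed_rballC (q : baire) : closed (~` \bigcup_i rball (X := X) (q i)).
Proof.
rewrite closedC openE => y [i _ qy]; apply: filterS (rball_nbhs qy) => z qz.
by exists i.
Qed.

(** * From cluster points to the jump of closed choice *)

Definition in_ball_by (p : baire) b i m : bool :=
  closer (unpairn b).1 (p (pairn i m)) m (unpairn b).2.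

(** The spare [2 ^- m] of [closerT] absorbs the error of the [m]-th Cauchy approximation.
    Conversely, that error and the [3 * 2 ^- m] of [closer_complete] add up to [4 * 2 ^- m], whence
    the factor [4^-1]. *)
Lemma in_ball_byP ps (x : nat -> X) b i :
  (forall i, cauchy_graph (ps i) (x i)) ->
  (exists m, in_ball_by (btuple ps) b i m) <-> rball b (x i).
Proof.
move=> psx; rewrite /in_ball_by /btuple; split=> [[m]|].
  rewrite pairnK/= => /closerT h; have := cauchy_mdist m (psx i) => h1.
  have := metric_triangle (alpha (unpairn b).1) (alpha (ps i m)) (x i).
  by rewrite /rball/= => h2; lra.
rewrite /rball/= -subr_gt0 => h; have h4 : 0 < 4^-1 :> R by [].
have [m mh] := expr2V_small (mulr_gt0 h h4).
exists m; rewrite pairnK/=; apply: closer_complete.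
have h1 := metric_triangle (alpha (unpairn b).1) (x i) (alpha (ps i m)).
have h2 := cauchy_mdist m (psx i); rewrite metric_sym in h2; lra.
Qed.

(** The position [n] codes a ball and a starting index; each [u < s] codes an offset from that index
    and a precision. Multiplying by the truth value sends a refuted ball to the empty ball [0]. *)
Definition avoided_balls (p : baire) : baire := btuple (fun s n =>
  (unpairn n).1 * all (fun u => ~~ in_ball_by p (unpairn n).1
    ((unpairn n).2 + (unpairn u).1) (unpairn u).2) (iota 0 s))%N.

Lemma rc_avoided_balls :
  rc (C := ctx_baire (@id baire)) (fun z => avoided_balls z.1 z.2).
Proof.
rewrite /avoided_balls /btuple; apply: rc_mul; first by rc_tac.
apply: (@rc_all (ctx_baire id) (fun z u => ~~ in_ball_by z.1
  (unpairn (unpairn z.2).2).1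
  ((unpairn (unpairn z.2).2).2 + (unpairn u).1) (unpairn u).2)); last by rc_tac.
apply: rc_negb; apply: rc_closer; rc_tac.
Qed.

Lemma cluster_le_choice : sW_le (cluster_point_problem X) (derivative (closed_choice X)).
Proof.
apply: (@sW_le_on _ _ _ _ _ baire id) rc_avoided_balls _ => //.
move=> p x [ps -> psx] [y0 cy0].
pose q n := if `[< forall i, ((unpairn n).2 <= i)%N -> ~ rball (unpairn n).1 (x i) >]
            then (unpairn n).1 else 0%N.
have limq : lim_graph (avoided_balls (btuple ps)) q.
  apply/lim_graphP => n; rewrite /q; case: asboolP => [nb|].
    exists 0%N => s _ /=; rewrite (_ : all _ _ = true) ?muln1//.
    apply/allP => u _; apply/negP => ub; apply: (nb ((unpairn n).2 + (unpairn u).1)%N).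
      exact: leq_addr.
    by apply/(in_ball_byP _ _ psx); exists (unpairn u).2.
  move=> /existsNP[i] /not_implyP[ni] /contrapT /(in_ball_byP _ _ psx)[m im].
  (* The hit [x i] is coded by the offset of [i] and the precision [m]; the successor puts this code
     inside [iota 0 s]. *)
  exists (pairn (i - (unpairn n).2) m).+1 => s us /=.
  rewrite (_ : all _ _ = false) ?muln0//; apply/negbTE/allPn.
  exists (pairn (i - (unpairn n).2) m); first by rewrite mem_iota.
  by rewrite negbK pairnK/= subnKC.
have qE y : (~` (\bigcup_i rball (q i))) y <-> cluster ((x : nat -> X) @ \oo) y.
  split.
    move=> qy; apply/cluster_seqP => U /rball_basis[b [yb bU]] N.
    apply: contrapT => nU; apply: qy; exists (pairn b N) => //; rewrite /q pairnK/=.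
    case: asboolP => // -[] i Ni xib; apply: nU; exists i => //; exact: bU.
  move=> /cluster_seqP cy [n _]; rewrite /q; case: asboolP => [nx ny|_]; last exact: rball0.
  by have [i ni /nx] := cy _ (rball_nbhs ny) (unpairn n).2; apply.
pose A : closed_subset X := exist _ _ (@closed_rballC q).
exists (btuple ps), A; split => //.
- by exists q.
- by exists y0; exact/qE.
- by move=> y /qE.
Qed.

(** * Greedy separated nets *)

Definition near_by k i j : bool := closer i j k (pairn 4 (2 ^ k).-1).

Lemma near_by_rat k : nnrat R (pairn 4 (2 ^ k).-1) = 4 * 2 ^- k.
Proof. by rewrite /nnrat pairnK/= prednK ?expn_gt0// natrX. Qed.

Lemma near_byT k i j : near_by k i j -> mdist (alpha i) (alpha j) < 3 * 2 ^- k.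
Proof. by move=> /closerT; rewrite near_by_rat => h; lra. Qed.

(** Rejection by [closer] can miss the radius by [3 * 2 ^- k]; the radius [4 * 2 ^- k] is chosen so
    that a separation of [2 ^- k] remains. *)
Lemma near_byF k i j : ~~ near_by k i j -> 2 ^- k <= mdist (alpha i) (alpha j).
Proof. by move=> /closerF; rewrite near_by_rat => h; lra. Qed.

Lemma rc_near_by (C : context) (k i j : C -> nat) : rc k -> rc i -> rc j ->
  rc (fun x => near_by (k x) (i x) (j x)).
Proof. by move=> rk ri rj; apply: rc_closer => //; rc_tac. Qed.

(* [in_net k] is the greedy [2 ^- k]-separated set of indices.  The membership
   bits of the indices below [j] are stacked in [net_hist k j]; the bit of [i]
   is the head after [j - i.+1] pops. *)
Definition net_step k w j : bool :=
  all (fun i => ~~ ((0 < (unpairn (iter (j - i.+1) (fun v => (unpairn v).2) w)).1)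
                    && near_by k i j)%N) (iota 0 j).

Definition net_hist k j : nat := iteri j (fun i w => pairn (net_step k w i) w) 0.

Definition in_net k j : bool := net_step k (net_hist k j) j.

Lemma net_hist_pop k m i :
  iter m (fun v => (unpairn v).2) (net_hist k (i + m)) = net_hist k i.
Proof.
elim: m => [|m IH]; first by rewrite addn0.
by rewrite iterSr addnS /= pairnK.
Qed.

Lemma in_netE k j :
  in_net k j = all (fun i => ~~ (in_net k i && near_by k i j)) (iota 0 j).
Proof.
apply: eq_in_all => i; rewrite mem_iota /= add0n => ij.
rewrite -[in net_hist k j](subnKC ij) net_hist_pop /= pairnK/=.
by rewrite -/(in_net k i) lt0b.
Qed.

Lemma in_net_separated k i j : in_net k i -> in_net k j -> i <> j ->
  2 ^- k <= mdist (alpha i) (alpha j).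
Proof.
wlog ij : i j / (i < j)%N => [wl ki kj nij|ki + _].
  have [/wl|/wl|//] := ltngtP i j; first exact.
  by rewrite metric_sym; apply => // ji; exact: nij.
rewrite in_netE => /allP/(_ i); rewrite mem_iota ij ki => /(_ isT).
exact: near_byF.
Qed.

(** An index is left out only when an earlier member is near it, so greediness gives density at the
    scale of [near_by]. *)
Lemma in_net_dense k i : exists2 j, in_net k j &
  mdist (alpha i) (alpha j) < 3 * 2 ^- k.
Proof.
have [ki|] := boolP (in_net k i).
  by exists i => //; rewrite mdistxx mulr_gt0// expr2V_gt0.
rewrite in_netE => /allPn[j _]; rewrite negbK => /andP[kj /near_byT ji].
by exists j => //; rewrite metric_sym.
Qed.

Lemma rc_net_step (C : context) (k w j : C -> nat) : rc k -> rc w -> rc j ->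
  rc (fun x => net_step (k x) (w x) (j x)).
Proof.
move=> rk rw rj; apply: (@rc_all C (fun x i =>
  ~~ ((0 < (unpairn (iter (j x - i.+1) (fun v => (unpairn v).2) (w x))).1)
      && near_by (k x) i (j x))%N)) => //.
apply: rc_negb; apply: rc_andb; last by apply: rc_near_by; rc_tac.
apply: rc_leq; rc_tac.
apply: (@rc_iter (ctx_ext C) (fun _ v => (unpairn v).2)); rc_tac.
Qed.

Lemma rc_in_net (C : context) (k j : C -> nat) : rc k -> rc j ->
  rc (fun x => in_net (k x) (j x)).
Proof.
move=> rk rj; apply: rc_net_step => //.
apply: (@rc_iteri C (fun x i w => pairn (net_step (k x) w i) w)) => //; last exact: rc_const.
by apply: rc_pairn; [apply: rc_net_step|]; rc_tac.
Qed.

(** * Firing events and their enumeration *)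

Definition fires (p : baire) j k s : bool :=
  [&& (k <= s)%N, in_net k.+2 j,
      (s == k) || ~~ all (fun i => p (pairn s i) == p (pairn s.-1 i)) (iota 0 k)
    & all (fun i => ~~ closer (unpairn (p (pairn s i))).1 j k
                          (unpairn (p (pairn s i))).2) (iota 0 k)].

Definition fires_at p e : bool :=
  fires p (unpairn (unpairn e).1).1 (unpairn (unpairn e).1).2 (unpairn e).2.

Lemma rc_fires (C : context) (j k s : C -> nat) : rc j -> rc k -> rc s ->
  rc (fun x => fires (ctx_oracle x) (j x) (k x) (s x)).
Proof.
move=> rj rk rs; apply: rc_andb; first by rc_tac.
apply: rc_andb; first by apply: rc_in_net => //; rc_tac.
apply: rc_andb; first apply: rc_orb; first by rc_tac.
- apply: rc_negb; apply: (@rc_all C (fun x i =>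
    ctx_oracle x (pairn (s x) i) == ctx_oracle x (pairn (s x).-1 i))) => //.
  rc_tac.
- apply: (@rc_all C (fun x i => ~~ closer (unpairn (ctx_oracle x (pairn (s x) i))).1
    (j x) (k x) (unpairn (ctx_oracle x (pairn (s x) i))).2)) => //.
  apply: rc_negb; apply: rc_closer; rc_tac.
Qed.

(** Unboundedly many firing codes make the search for the next event total, so [rc_mu] applies on
    these oracles. *)
Definition firing_names : Type :=
  {p : baire | forall t, exists n, (t <= n)%N && fires_at p n}.

Definition next_event (p : firing_names) t : nat := ex_minn (svalP p t).

Lemma next_event_ge p t : (t <= next_event p t)%N.
Proof. by rewrite /next_event; case: ex_minnP => n /andP[]. Qed.

Lemma next_event_fires p t : fires_at (sval p) (next_event p t).
Proof. by rewrite /next_event; case: ex_minnP => n /andP[]. Qed.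

(** Every firing event occurs in the enumeration at the index equal to its own code. *)
Lemma next_event_id p e : fires_at (sval p) e -> next_event p e = e.
Proof.
move=> pe; apply/eqP; rewrite eqn_leq next_event_ge andbT /next_event.
by case: ex_minnP => n _; apply; rewrite leqnn.
Qed.

Definition event_points (p : firing_names) : baire :=
  btuple (fun t _ => (unpairn (unpairn (next_event p t)).1).1).

Lemma rc_event_points :
  rc (C := ctx_baire (fun p : firing_names => sval p))
     (fun z => event_points z.1 z.2).
Proof.
set C := ctx_baire _; rewrite /event_points /btuple.
apply: rc_unpair1; apply: rc_unpair1.
apply: (@rc_mu C (fun z n => ((unpairn z.2).1 <= n) && fires_at (sval z.1) n)%N).
- by move=> z; rewrite next_event_ge next_event_fires.
- by move=> z m; rewrite /next_event; case: ex_minnP => n _; apply.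
apply: rc_negb; apply: rc_andb; first by rc_tac.
apply: (@rc_fires (ctx_ext C)); rc_tac.
Qed.

(** * Events along a convergent sequence of names *)

Section Events.
Variables (qs : nat -> baire) (q : baire).
Hypothesis qs_lim : forall i, exists N, forall s, (N <= s)%N -> qs s i = q i.

Lemma lim_prefix k :
  exists N, forall s, (N <= s)%N -> forall i, (i < k)%N -> qs s i = q i.
Proof.
elim: k => [|k [N IH]]; first by exists 0%N.
have [M kM] := qs_lim k; exists (maxn N M) => s; rewrite geq_max => /andP[Ns Ms] i.
by rewrite ltnS leq_eqVlt => /predU1P[->|]; [exact: kM | exact: IH].
Qed.

Lemma firesP j k s : fires (btuple qs) j k s <->
  [/\ (k <= s)%N, in_net k.+2 j,
      s = k \/ exists2 i, (i < k)%N & qs s i <> qs s.-1 i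
    & forall i, (i < k)%N ->
        ~~ closer (unpairn (qs s i)).1 j k (unpairn (qs s i)).2].
Proof.
have bE t i : btuple qs (pairn t i) = qs t i by rewrite /btuple pairnK.
split=> [/and4P[ks kj cs /allP ts]|[ks kj cs ts]].
  split=> //; last first.
    by move=> i ik; have := ts i; rewrite bE mem_iota; apply.
  case/orP: cs => [/eqP|/allPn[i]]; first by left.
  by rewrite mem_iota !bE => ik /eqP; right; exists i.
apply/and4P; split => //.
  case: cs => [->|[i ik /eqP qi]]; first by rewrite eqxx.
  by apply/orP; right; apply/allPn; exists i; rewrite ?mem_iota ?bE.
by apply/allP => i; rewrite mem_iota bE; exact: ts.
Qed.

(* The witness for [s] is the last stage at which the first [k] entries change. *)
Lemma fires_near (y : X) k : (forall i, ~ rball (q i) y) ->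
  exists j s, fires (btuple qs) j k s /\ mdist (alpha j) y < 2 ^- k.
Proof.
move=> qy.
(* The net at level [k.+2] costs [3 * 2 ^- k.+2], which with the [2 ^- k.+2] of the dense point adds
   up to [2 ^- k]. *)
have [i iy] := dense_approx y (expr2V_gt0 R k.+2).
have [j kj ij] := in_net_dense k.+2 i.
have jy : mdist (alpha j) y < 2 ^- k.
  have h1 := metric_triangle (alpha j) (alpha i) y.
  rewrite (metric_sym (alpha j) (alpha i)) in h1.
  by have h2 := expr2VS R k; have h3 := expr2VS R k.+1; lra.
have exs : exists s, (k <= s)%N && `[< forall t, (s <= t)%N ->
    forall i, (i < k)%N -> qs t i = q i >].
  have [N Nq] := lim_prefix k; exists (maxn k N); rewrite leq_maxl; apply/asboolP.
  by move=> t; rewrite geq_max => /andP[_]; exact: Nq.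
case: (ex_minnP exs) => s /andP[ks /asboolP sq] smin.
exists j, s; split => //; apply/firesP; split => // [|a ak].
  have [->|sk] := eqVneq s k; [by left | right].
  have {sk}ks : (k < s)%N by rewrite ltn_neqAle eq_sym sk.
  apply: contrapT => nc; suff : (s <= s.-1)%N by case: (s) ks => //= s' _; rewrite ltnn.
  apply: smin; rewrite -ltnS (ltn_predK ks) ks; apply/asboolP => t st a ak.
  move: st; rewrite leq_eqVlt (ltn_predK ks) => /predU1P[<-|/sq]; last exact.
  by apply: contrapT => qa; apply: nc; exists a => //; rewrite sq// => /esym.
(* Acceptance leaves [2 ^- k] to spare, more than the distance from [alpha j] to [y], and would put
   [y] in a removed ball. *)
rewrite sq//; apply/negP => /closerT h.
apply: (qy a); rewrite /rball/=.
by have := metric_triangle (alpha (unpairn (q a)).1) (alpha j) y; lra.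
Qed.

Lemma fires_infinite (y : X) : (forall i, ~ rball (q i) y) ->
  forall t, exists n, (t <= n)%N && fires_at (btuple qs) n.
Proof.
move=> qy t; have [j [s [jts _]]] := fires_near t qy.
exists (pairn (pairn j t) s); rewrite /fires_at !pairnK/= jts andbT.
exact: leq_trans (pairn_ger _ _) (pairn_gel _ _).
Qed.

Lemma fires_stage_bounded k :
  exists N, forall j s, fires (btuple qs) j k s -> (s <= N)%N.
Proof.
have [N Nq] := lim_prefix k; exists (maxn k N) => j s /firesP[ks _ cs _].
rewrite leqNgt gtn_max; apply/negP => /andP[ks' Ns].
case: cs => [sk|[i ik]]; first by rewrite sk ltnn in ks'.
by rewrite !Nq//; [rewrite -ltnS (ltn_predK Ns) | exact: ltnW].
Qed.

Lemma fires_precision_bounded i (y : X) : rball (q i) y ->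
  exists M, forall j k s, fires (btuple qs) j k s ->
    mdist (alpha j) y < 2 ^- M -> (k < M)%N.
Proof.
rewrite /rball/= -subr_gt0 => h; have h4 : 0 < 4^-1 :> R by [].
have [m mh] := expr2V_small (mulr_gt0 h h4).
have [N Nq] := qs_lim i.
(* For [k] at least this bound, ball [i] is among those tested and its entry has reached its limit,
   while [m] makes the total error [4 * 2 ^- m] smaller than the margin of [y] inside the ball. *)
exists (maxn m (maxn i.+1 N)); set M := maxn _ _ => j k s /firesP[ks _ _ ts] jy.
rewrite ltnNge; apply/negP => Mk.
have mM : (m <= M)%N by exact: leq_maxl.
have iM : (i < M)%N by rewrite /M 2!leq_max leqnn orbT.
have NM : (N <= M)%N by rewrite /M 2!leq_max leqnn !orbT.
have := ts i (leq_trans iM Mk); rewrite Nq ?(leq_trans NM (leq_trans Mk ks))//.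
move=> /closerF; have := metric_triangle (alpha (unpairn (q i)).1) y (alpha j).
rewrite (metric_sym y) => h1 h2.
by have := ler_expr2V R mM; have := ler_expr2V R (leq_trans mM Mk); lra.
Qed.

(** Near a removed point the precision is bounded, each precision has finitely many stages, and
    separation allows one [j] per precision. *)
Lemma fires_event_bounded i (y : X) : rball (q i) y ->
  exists e N, 0 < e /\ forall j k s, fires (btuple qs) j k s ->
    mdist (alpha j) y < e -> (pairn (pairn j k) s <= N)%N.
Proof.
(* Two net points within [2 ^- M.+3] of [y] are less than [2 ^- M.+2] apart, which for [k < M] is
   below the separation [2 ^- k.+2]. *)
move=> /fires_precision_bounded[M MP]; exists (2 ^- M.+3).
have /choice[B BP] : forall k, exists B, forall j s, (k < M)%N ->
    fires (btuple qs) j k s -> mdist (alpha j) y < 2 ^- M.+3 ->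
    (pairn (pairn j k) s <= B)%N.
  move=> k; have [S SP] := fires_stage_bounded k.
  have [[kM [j0 [s0 [f0 d0]]]]|no] := pselect ((k < M)%N /\ exists j0 s0,
      fires (btuple qs) j0 k s0 /\ mdist (alpha j0) y < 2 ^- M.+3); last first.
    by exists 0%N => j s kM fj dj; exfalso; apply: no; split => //; exists j, s.
  exists (\max_(s < S.+1) pairn (pairn j0 k) s) => j s _ fj dj.
  have -> : j = j0.
    apply: contrapT => jj0; have [_ nj _ _] := (firesP _ _ _).1 fj.
    have [_ nj0 _ _] := (firesP _ _ _).1 f0.
    have h1 := in_net_separated nj nj0 jj0.
    have h2 := metric_triangle (alpha j) y (alpha j0).
    rewrite (metric_sym y) in h2; have h3 := expr2VS R M.+2.
    by have := ler_expr2V R (leq_trans kM (leqnSn M) : (k.+2 <= M.+2)%N); lra.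
  have sS : (s < S.+1)%N by rewrite ltnS; exact: SP fj.
  exact: (leq_bigmax (Ordinal sS)).
exists (\max_(k < M) B k); split; first exact: expr2V_gt0.
move=> j k s fj dj; have kM : (k < M)%N.
  by apply: MP fj _; rewrite (lt_le_trans dj)// ler_expr2V// -addn3 leq_addr.
exact: leq_trans (BP _ _ _ kM fj dj) (leq_bigmax (Ordinal kM)).
Qed.

End Events.

Lemma choice_le_cluster :
  sW_le (derivative (closed_choice X)) (cluster_point_problem X).
Proof.
apply: (@sW_le_on _ _ _ _ _ firing_names (fun p => sval p)) rc_event_points _.
  by move=> [p hp] [p' hp'] /= pp'; exact: eq_exist.
move=> p A [q [[qs pE qsq] qA]] [y0 Ay0].
have qsP : forall i, exists N, forall s, (N <= s)%N -> qs s i = q i.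
  by apply/lim_graphP; exists qs.
have AE y : sval A y <-> forall i, ~ rball (q i) y.
  rewrite qA; split=> [h i qy|h [i _ qy]]; last exact: h qy.
  by apply: h; exists i.
have pfires := fires_infinite qsP ((AE y0).1 Ay0); rewrite -pE in pfires.
pose e : firing_names := exist _ p pfires.
pose x t : X := alpha (unpairn (unpairn (next_event e t)).1).1.
exists e, x; split => //.
- by exists (fun t _ => (unpairn (unpairn (next_event e t)).1).1) => // t; exact: cauchy_const.
- exists y0; apply/cluster_seqP => U /nbhs_ballP[d /= d0 dU] N.
  have [m md] := expr2V_small d0.
  (* Precision [maxn N m] makes the point [2 ^- m]-close to [y0] and the event code at least [N]. *)
  have [j [s [fjs jy]]] := fires_near qsP (maxn N m) ((AE y0).1 Ay0).
  exists (pairn (pairn j (maxn N m)) s).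
    apply: leq_trans (pairn_gel _ _); apply: leq_trans (pairn_ger _ _).
    exact: leq_maxl.
  rewrite /x next_event_id ?/fires_at ?pairnK /= ?pE//.
  apply: dU; rewrite ballEmdist/= metric_sym (lt_trans jy)// (le_lt_trans _ md)//.
  by rewrite ler_expr2V// leq_maxr.
- move=> y /cluster_seqP cy; apply/AE => i /(fires_event_bounded qsP)[d [N [d0 dN]]].
  (* A term of index beyond [N] comes from an event code beyond [N], which [dN] excludes this close
     to [y]. *)
  have /cy/(_ N.+1)[t Nt] : nbhs y (ball y d) by exact: nbhsx_ballx.
  rewrite ballEmdist/= metric_sym => yt.
  have := next_event_fires e t; rewrite /= pE => /dN /(_ yt).
  by rewrite !unpairnK leqNgt (leq_trans Nt)// next_event_ge.
Qed.

End ComputableMetric.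

Theorem theorem9p4 (R : realType) (X : compMetricSpace R) :
  sW_equiv (derivative (closed_choice X)) (cluster_point_problem X).
Proof.
have [f f_computable fP] := @cms_dist R X.
by split; [exact: choice_le_cluster fP | exact: cluster_le_choice fP].
Qed.
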